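(* Let $\mathscr{L}$ be a bounded distributive lattice, let $S \subseteq \mathscr{L}$ be $\vee$-closed, and let $\{\mathfrak{q}_i\}_{i \in \Delta}$ be a nonempty set of $S$-filters of $\mathscr{L}$. Then $\bigcap_{i \in \Delta} \mathfrak{q}_i$ is an $S$-filter of $\mathscr{L}$.
   Context: A bounded lattice has a least element $0$ and a greatest element $1$. A filter of $\mathscr{L}$ is a non-empty subset $F \subseteq \mathscr{L}$ such that $u \wedge v \in F$ for all $u,v \in F$, and $u \in F$, $w \in \mathscr{L}$, $u \le w$ imply $w \in F$; it is proper if $F \ne \mathscr{L}$. A subset $S \subseteq \mathscr{L}$ is $\vee$-closed if $0 \in S$ and $s_1 \vee s_2 \in S$ for all $s_1,s_2 \in S$. For a $\vee$-closed $S$, a proper filter $\mathfrak{q}$ of $\mathscr{L}$ is an $S$-filter if for all $u,v \in \mathscr{L}$, $u \vee v \in \mathfrak{q}$ and $u \in S$ imply $v \in \mathfrak{q}$. *)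

(* Defs.v *)
From mathcomp Require Import all_boot all_order.
From mathcomp Require Import boolp classical_sets.

Set Implicit Arguments.
Unset Strict Implicit.
Unset Printing Implicit Defensive.

Import Order.TTheory.
Local Open Scope classical_set_scope.

(* Meets, joins and bounds of the lattice are delimited by %O because the
   infix symbols for meet and join also denote set intersection and union. *)

Definition lattice_filter (d : Order.disp_t) (L : tbDistrLatticeType d)
    (F : set L) : Prop :=
  [/\ F !=set0,
      forall u v : L, F u -> F v -> F (u `&` v)%O
    & forall u w : L, F u -> (u <= w)%O -> F w].

Definition proper_lattice_filter (d : Order.disp_t) (L : tbDistrLatticeType d)
    (F : set L) : Prop :=
  lattice_filter F /\ F <> setT.

Definition join_closed (d : Order.disp_t) (L : tbDistrLatticeType d)
    (S : set L) : Prop :=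
  S (\bot)%O /\ forall s1 s2 : L, S s1 -> S s2 -> S (s1 `|` s2)%O.

Definition S_filter (d : Order.disp_t) (L : tbDistrLatticeType d)
    (S q : set L) : Prop :=
  proper_lattice_filter q /\
  forall u v : L, q (u `|` v)%O -> S u -> q v.

(* Main.v *)
Require Import Defs.
From mathcomp Require Import all_boot all_order.
From mathcomp Require Import boolp classical_sets.

Local Open Scope classical_set_scope.

(** Every clause in the definition of an S-filter other than nonemptiness and
    properness is a closure condition, and a closure condition passes to
    intersections because it can be checked in each member separately.
    Nonemptiness is not inherited by intersections in general, but all filters
    of a bounded lattice share the greatest element ([lattice_filter_top]).
    Properness comes from the family being nonempty: the intersection lies
    inside some member, which already misses a point. *)

Lemma lattice_filter_top (d : Order.disp_t) (L : tbDistrLatticeType d)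
    (F : set L) : lattice_filter F -> F (\top)%O.
Proof. by case=> -[x Fx] _ upF; exact: upF Fx (Order.lex1 x). Qed.

Lemma lattice_filter_bigcap (d : Order.disp_t) (L : tbDistrLatticeType d)
    (I : Type) (Delta : set I) (q : I -> set L) :
  (forall i, Delta i -> lattice_filter (q i)) ->
  lattice_filter (\bigcap_(i in Delta) q i).
Proof.
move=> filq; split.
- by exists (\top)%O => i Di; exact: lattice_filter_top (filq i Di).
- move=> u v qu qv i Di; have [_ meetq _] := filq i Di.
  by apply: meetq; [exact: qu | exact: qv].
- move=> u w qu le_uw i Di; have [_ _ upq] := filq i Di.
  exact: upq (qu i Di) le_uw.
Qed.

Theorem proposition3p9 (d : Order.disp_t) (L : tbDistrLatticeType d)
    (S : set L) (hS : join_closed S)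
    (I : Type) (Delta : set I) (q : I -> set L)
    (hDelta : Delta !=set0)
    (hq : forall i : I, Delta i -> S_filter S (q i)) :
  S_filter S (\bigcap_(i in Delta) q i).
Proof.
split; first split.
- by apply: lattice_filter_bigcap => i Di; have [[]] := hq i Di.
- have [i Di] := hDelta; have [[_ properq] _] := hq i Di.
  move=> capT; apply: properq; apply/seteqP; split=> // x _.
  have capx : (\bigcap_(j in Delta) q j) x by rewrite capT.
  exact: capx i Di.
- move=> u v quv Su i Di; have [_ Sq] := hq i Di.
  exact: Sq (quv i Di) Su.
Qed.
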